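(* Let $1\le p<\infty$ and $q\ge1$, and let $T$ be a linear operator from $L^p(\mathfrak X)$ into the space of functions from $\mathfrak X$ to $\mathbb C$. If $T$ is a $(p,q)$-weak operator, with constant $C>0$ in the weak type inequality, then $T:L^p(\mathfrak X)\to L^r(\mathfrak X)$ is a bounded operator for all $r>q+1$ ($r<\infty$). Moreover, $$\|T\|_{B(L^p(\mathfrak X),L^r(\mathfrak X))}\le C^{\frac qr}\left(\sum_{k=2}^\infty\frac{k^q}{(k-1)^r}+(2C)^r\right)^{\frac1r}.$$
   Context: $\mathfrak X$ is (the vertex set of) a homogeneous tree of degree $\kappa+1$, $\kappa\ge2$ an integer: a connected graph without loops (cycles) in which every vertex has exactly $\kappa+1$ neighbours. It carries the counting measure $\vartheta$, and $L^p(\mathfrak X)$ is taken with respect to $\vartheta$. A linear operator $T$ from $L^p(\mathfrak X)$ into the functions $\mathfrak X\to\mathbb C$ is a $(p,q)$-weak operator ($1\le q<\infty$) if there is $C>0$ such that for all $f\in L^p(\mathfrak X)$ and all $\lambda>0$, $$\vartheta(\{x\in\mathfrak X:|Tf(x)|>\lambda\})\le\left(C\,\frac{\|f\|_{L^p(\mathfrak X)}}{\lambda}\right)^q.$$ *)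

(* Defs.v *)
From HB Require Import structures.
From mathcomp Require Import all_boot all_order all_algebra.
From mathcomp Require Import all_classical all_reals all_analysis.
From mathcomp Require Import complex.

Set Implicit Arguments.
Unset Strict Implicit.
Unset Printing Implicit Defensive.

Import Order.TTheory GRing.Theory Num.Theory.

Local Open Scope classical_set_scope.
Local Open Scope ring_scope.

Section HomogeneousTree.
Variables (X : choiceType) (e : rel X).

Definition connected_graph : Prop :=
  forall x y : X, exists2 s : seq X, path e x s & last x s = y.

(* The length condition excludes the back-and-forth closed walks [:: x; y],
   which are simple cycles in the sense of ucycle. *)
Definition acyclic_graph : Prop :=
  forall c : seq X, (2 < size c)%N -> ~ ucycle e c.

Definition homogeneous_tree (kappa : nat) : Prop :=
  [/\ symmetric e, irreflexive e, connected_graph, acyclic_graph &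
      forall x : X, ([set y | e x y] #= `I_kappa.+1)%card].

End HomogeneousTree.

(* The type X equipped with the sigma-algebra of all its subsets. *)
Definition discrete (X : pointedType) : Type := X.

HB.instance Definition _ (X : pointedType) := Pointed.on (discrete X).
HB.instance Definition _ (X : pointedType) :=
  @isMeasurable.Build default_measure_display (discrete X)
    discrete_measurable discrete_measurable0
    discrete_measurableC discrete_measurableU.

Section LpSpaces.
Context {R : realType} {X : pointedType}.
Implicit Types (f g : X -> R[i]) (T : (X -> R[i]) -> (X -> R[i])).

Definition LpNorm (p : R) f : \bar R :=
  Lnorm (@counting (discrete X) R) p%:E
    (fun x : discrete X => (Normc.normc (f x))%:E).

Definition Lp (p : R) : set (X -> R[i]) := [set f | (LpNorm p f < +oo)%E].

(* Operators with domain Lp p are represented by maps on all functions; only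
   their values on Lp p are ever used. *)
Definition linear_on_Lp (p : R) T : Prop :=
  forall (a : R[i]) f g, Lp p f -> Lp p g ->
    T (fun x => a * f x + g x) = (fun x => a * T f x + T g x).

Definition weak_type_bound (p q C : R) T : Prop :=
  forall f, Lp p f -> forall lambda : R, 0 < lambda ->
    (@counting X R [set x | (lambda < Normc.normc (T f x))%R]
       <= (C%:E * LpNorm p f * lambda^-1%:E) `^ q)%E.

Definition weak_operator (p q C : R) T : Prop :=
  [/\ linear_on_Lp p T, 0 < C & weak_type_bound p q C T].

Definition bounded_operator (p r : R) T : Prop :=
  [/\ linear_on_Lp p T,
      forall f, Lp p f -> Lp r (T f) &
      exists2 M : R, 0 <= M &
        forall f, Lp p f -> (LpNorm r (T f) <= M%:E * LpNorm p f)%E].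

Definition operator_norm (p r : R) T : \bar R :=
  ereal_sup [set LpNorm r (T f) | f in [set f | Lp p f /\ (LpNorm p f <= 1)%E]].

End LpSpaces.

(* Main.v *)
(* The counting measure has no nonempty set of measure below 1, so the weak type
   inequality at a level above [C * N], where [N] is the norm of [f], leaves no
   room for any point: [|T f| <= C * N] everywhere. For [h = |T f| / N], the
   layers [1/k < h <= 1/(k-1)], [k >= 2], contribute at most
   [(C k)^q / (k-1)^r] each to the integral of [h^r], and [h > 1] contributes
   at most [C^q C^r <= C^q (2C)^r]. *)

Require Import Defs.
From HB Require Import structures.
From mathcomp Require Import all_boot all_order all_algebra.
From mathcomp Require Import all_classical all_reals all_analysis.
From mathcomp Require Import measurable_realfun.
From mathcomp Require Import complex finmap.
From mathcomp Require Import ring lra.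

Import Order.TTheory GRing.Theory Num.Theory.

Local Open Scope classical_set_scope.
Local Open Scope ring_scope.

(* From [(1 - 1/k)^-a >= exp(a/k) >= 1 + a/k]. *)
Lemma powR_inv_telescope (R : realType) (a : R) (k : nat) :
  0 < a -> (1 < k)%N ->
  (k%:R `^ (1 + a))^-1 <= a^-1 * ((k.-1%:R `^ a)^-1 - (k%:R `^ a)^-1).
Proof.
move=> a0 k1; have k0 : 0 < k%:R :> R by rewrite ltr0n (ltn_trans _ k1).
have Em : k.-1%:R = k%:R * (1 - k%:R^-1) :> R.
  by rewrite mulrBr mulfV ?gt_eqF// mulr1 -subn1 natrB// ltnW.
have c0 : 0 < 1 - k%:R^-1 :> R.
  by rewrite -(pmulr_rgt0 _ k0) -Em ltr0n -ltnS prednK// (ltn_trans _ k1).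
rewrite powRD; last by rewrite (gt_eqF k0) implybT.
rewrite powRr1 ?(ltW k0)// Em powRM ?(ltW k0) ?(ltW c0)// !invfM.
rewrite mulrC -[X in _ - X]mulr1 -mulrBr mulrCA ler_pM2l ?invr_gt0 ?powR_gt0//.
rewrite ler_pdivlMl// lerBrDl -powRN /powR gt_eqF//.
apply: le_trans (expR_ge1Dx _) _; rewrite ler_expR mulNr -mulrN ler_pM2l//.
rewrite lerNr; apply: le_ln1Dx.
by rewrite ltrN2 invf_lt1// ltr1n.
Qed.

(** For [k >= 2] one has [k <= 2 (k-1)], so each term is at most [2^r k^(q-r)]. Since
    [q - r = -(1 + a)] with [a > 0], the telescoping bound on [k^-(1+a)] applies. *)
Lemma weak_series_lty (R : realType) (q r : R) : 0 <= q -> q + 1 < r ->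
  (\sum_(2 <= k <oo) (k%:R `^ q / k.-1%:R `^ r)%:E < +oo)%E.
Proof.
move=> q0 qr; set a := r - q - 1.
have a0 : 0 < a by rewrite /a; lra.
pose c := 2 `^ r * a^-1.
have c0 : 0 <= c by rewrite mulr_ge0 ?powR_ge0// invr_ge0 ltW.
have term k : (2 <= k)%N ->
    k%:R `^ q / k.-1%:R `^ r <= c * ((k.-1%:R `^ a)^-1 - (k%:R `^ a)^-1) :> R.
  move=> k2; have k0 : 0 < k%:R :> R by rewrite ltr0n (ltn_trans _ k2).
  have m0 : 0 < k.-1%:R :> R by rewrite ltr0n -ltnS prednK// (ltn_trans _ k2).
  have km : k%:R <= 2 * k.-1%:R :> R.
    rewrite -natrM ler_nat; case: k k2 {k0 m0} => [//|[//|n _]].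
    by rewrite mul2n -addnn /= addnS ltnS leq_addr.
  rewrite -mulrA.
  apply: (@le_trans _ _ (2 `^ r * (k%:R `^ (1 + a))^-1)); last first.
    by rewrite ler_pM2l ?powR_gt0// powR_inv_telescope.
  have -> : 1 + a = r - q by rewrite /a; ring.
  rewrite powRB; last by rewrite (gt_eqF k0) implybT.
  rewrite invf_div mulrCA ler_pM2l ?powR_gt0//.
  rewrite -ler_pdivrMl ?powR_gt0// -invfM -powRM ?(ltW m0)//.
  rewrite lef_pV2 ?posrE ?powR_gt0 ?mulr_gt0//.
  by rewrite ge0_ler_powR ?nnegrE ?(ltW k0) ?mulr_ge0 ?(ltW m0)//; lra.
(* The telescoping sum starts at [(2-1)^-a = 1], so all partial sums stay below [c]. *)
have part n : (2 <= n)%N ->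
    \sum_(2 <= k < n) (k%:R `^ q / k.-1%:R `^ r) <=
    c * (1 - (n.-1%:R `^ a)^-1) :> R.
  elim: n => // n IH; rewrite leq_eqVlt => /predU1P[<-|].
    by rewrite big_geq// powR1 invr1 subrr mulr0.
  rewrite ltnS => n2.
  rewrite big_nat_recr//= (le_trans (lerD (IH n2) (term n n2)))// -mulrDr.
  by rewrite addrA subrK.
apply: (@le_lt_trans _ _ c%:E); last exact: ltry.
apply: lime_le.
  by apply: is_cvg_nneseries => n _ _; rewrite lee_fin divr_ge0 ?powR_ge0.
near=> n; rewrite sumEFin lee_fin (le_trans (part n _))//.
  by near: n; exists 2%N.
by rewrite ler_piMr// gerBl invr_ge0 powR_ge0.
Unshelve. all: by end_near. Qed.

(** The power [h^r] is dominated pointwise by weighted indicators of the level sets [h > 1/k],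
    [k >= 2], and [h > 1]. Integrating term by term leaves only measures of level sets, which [weak]
    controls. The bound [K] serves as the weight on [h > 1]. *)
Lemma ge0_integral_powR_weak d (T : measurableType d) (R : realType)
    (mu : {measure set T -> \bar R}) (h : T -> R) (C K q r : R) :
  0 <= C -> 0 <= K -> 0 < r -> measurable_fun [set: T] h ->
  (forall x, 0 <= h x <= K) ->
  (forall l : R, 0 < l -> (mu [set x | (l < h x)%R] <= ((C / l) `^ q)%:E)%E) ->
  (\int[mu]_x (h x `^ r)%:E <=
   (C `^ q)%:E *
     (\sum_(2 <= k <oo) (k%:R `^ q / k.-1%:R `^ r)%:E + (K `^ r)%:E))%E.
Proof.
move=> C0 K0 r0 mh hK weak.
pose E (l : R) := [set x | l < h x].
have mE l : measurable (E l).
  have -> : E l = [set: T] `&` h @^-1` `]l, +oo[.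
    by rewrite setTI; apply/seteqP; split=> x; rewrite /E /= in_itv/= andbT.
  by apply: mh => //; exact: measurable_itv.
(* The value 0 for [k < 2] lets the series run over all naturals; the final series is brought to the
   same form before comparing terms. *)
pose F (k : nat) x : \bar R :=
  (if (2 <= k)%N then ((k.-1%:R^-1) `^ r)%:E * (\1_(E k%:R^-1) x)%:E else 0)%E.
have F0 k x : (0 <= F k x)%E.
  by rewrite /F; case: ifP => // _; rewrite -EFinM lee_fin mulr_ge0 ?powR_ge0.
have mF k : measurable_fun [set: T] (F k).
  rewrite /F; case: (2 <= k)%N => //.
  by apply: measurable_funeM; apply/measurable_EFinP; exact: measurable_indic.
pose G x : \bar R := ((K `^ r)%:E * (\1_(E 1) x)%:E)%E.
have G0 x : (0 <= G x)%E by rewrite /G -EFinM lee_fin mulr_ge0 ?powR_ge0.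
have mG : measurable_fun [set: T] G.
  by apply: measurable_funeM; apply/measurable_EFinP; exact: measurable_indic.
(* If [1/k < h x <= 1/(k-1)], the [k]-th term alone suffices, so the sets
   [E k^-1] need not be cut down to disjoint layers. *)
have hFG x : ((h x `^ r)%:E <= (\sum_(k <oo) F k x) + G x)%E.
  have /andP[h0 hx] := hK x.
  have [h1|h1] := ltP 1 (h x).
    apply: (@le_trans _ _ (G x)); last first.
      by rewrite leeDr// nneseries_ge0.
    rewrite /G indicE mem_set//= mule1 lee_fin.
    by rewrite ge0_ler_powR ?nnegrE// ltW.
  apply: (@le_trans _ _ (\sum_(k <oo) F k x)%E); last by rewrite leeDl.
  have [->|hn0] := eqVneq (h x) 0.
    by rewrite powR0 ?gt_eqF// nneseries_ge0.
  have hp : 0 < h x by rewrite lt_neqAle eq_sym hn0.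
  (* From [n <= 1/h < n+1] follows [1/(n+1) < h <= 1/n], so [x] lies in the layer of index
     [k = n+1]. *)
  set n := Num.truncn (h x)^-1.
  have n1 : (1 <= n)%N by rewrite truncn_gt0 invf_ge1.
  have /andP[nl nr] : n%:R <= (h x)^-1 < n.+1%:R.
    by rewrite truncn_itv// invr_ge0.
  apply: (@le_trans _ _ (F n.+1 x)).
    rewrite /F ltnS n1 indicE mem_set/= ?mule1.
      rewrite lee_fin ge0_ler_powR ?nnegrE// ?(ltW r0) ?invr_ge0//.
      by rewrite -[leLHS]invrK lef_pV2 ?posrE ?invr_gt0 ?ltr0n.
    by rewrite /E/= -[ltRHS]invrK ltf_pV2 ?posrE ?invr_gt0 ?ltr0n.
  by rewrite (@nneseriesD1 _ _ n.+1)// leeDl// nneseries_ge0.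
apply: (@le_trans _ _ (\int[mu]_x ((\sum_(k <oo) F k x) + G x))%E).
  apply: ge0_le_integral => //.
  - by move=> x _; rewrite lee_fin powR_ge0.
  - by apply/measurable_EFinP; exact: (measurableT_comp (measurable_powR r)) mh.
  - by apply: emeasurable_funD => //; apply: ge0_emeasurable_sum.
rewrite ge0_integralD//; last 2 first.
- by move=> x _; exact: nneseries_ge0.
- by apply: ge0_emeasurable_sum.
rewrite integral_nneseries// ge0_muleDr ?lee_fin ?powR_ge0//; last first.
  by apply: nneseries_ge0 => k _ _; rewrite lee_fin divr_ge0 ?powR_ge0.
apply: leeD.
  rewrite -nneseriesZl; last first.
    by move=> k _; rewrite lee_fin divr_ge0 ?powR_ge0.
  rewrite [leRHS]eseries_cond [leRHS]eseries_mkcond.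
  apply: lee_nneseries => [k _ _|k _]; first exact: integral_ge0.
  rewrite /F/=; case: ifPn => [k2|_]; last by rewrite integral0.
  rewrite ge0_integralZl_EFin//; last first.
    by apply/measurable_EFinP; exact: measurable_indic.
  rewrite integral_indic// setIT.
  have k0 : 0 < k%:R :> R by rewrite ltr0n (ltn_trans _ k2).
  (* At level [1/k] the weak bound is [(C k)^q], the source of the numerator [k^q]. *)
  apply: (le_trans (lee_wpmul2l _ (weak k%:R^-1 _))).
  - by rewrite lee_fin powR_ge0.
  - by rewrite invr_gt0.
  rewrite -!EFinM lee_fin invrK powRM// ?(ltW k0)//.
  by rewrite -powR_inv1// -powRrM mulN1r powRN mulrC mulrA.
rewrite ge0_integralZl_EFin ?powR_ge0//; last first.
  by apply/measurable_EFinP; exact: measurable_indic.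
rewrite integral_indic// setIT muleC lee_wpmul2r ?lee_fin ?powR_ge0//.
by apply: le_trans (weak 1 _) _; rewrite ?divr1.
Qed.

Lemma counting_ge1 (R : realType) (X : choiceType) (A : set X) (x : X) :
  A x -> (1 <= @counting X R A)%E.
Proof.
move=> Ax; rewrite /counting; case: ifPn => [/asboolP fA|_]; last exact: leey.
rewrite lee_fin ler1n lt0n cardfs_eq0; apply/fset0Pn; exists x.
by rewrite in_fset_set// mem_set.
Qed.

Lemma counting_weak_bounded (R : realType) (X : choiceType) (h : X -> R)
    (K q : R) : 0 <= K -> 0 < q ->
  (forall l : R, 0 < l ->
     (@counting X R [set x | (l < h x)%R] <= ((K / l) `^ q)%:E)%E) ->
  forall x, h x <= K.
Proof.
move=> K0 q0 weak x; rewrite leNgt; apply/negP => Kh.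
(* At a level [l] strictly between [K] and [h x], the level set contains [x] and so has measure at
   least 1, while [(K/l)^q < 1]. *)
have [] := midf_lt Kh; move: (_ / _) => l Kl lh.
have l0 : 0 < l by exact: le_lt_trans Kl.
have := le_trans (@counting_ge1 R X [set y | (l < h y)%R] x lh) (weak l l0).
rewrite lee_fin leNgt => /negP; apply.
have -> : 1 = 1 `^ q :> R by rewrite powR1.
apply: gt0_ltr_powR; rewrite ?nnegrE ?divr_ge0 ?(ltW l0)//.
by rewrite ltr_pdivrMr// mul1r.
Qed.

(** Dividing [|T f|] by the norm [N] of [f] turns both the weak type constant and the uniform bound
    into [C], so the integral estimate applies with [K = C]. *)
Lemma weak_operator_Lnorm_le (R : realType) (X : pointedType) (p q C r : R)
    (T : (X -> R[i]) -> (X -> R[i])) (f : X -> R[i]) :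
  0 < q -> 0 < r -> 0 < C -> weak_type_bound p q C T -> Lp p f ->
  (LpNorm r (T f) <=
     (C `^ (q / r))%:E *
     (\sum_(2 <= k <oo) (k%:R `^ q / k.-1%:R `^ r)%:E + ((2 * C) `^ r)%:E)
       `^ r^-1 * LpNorm p f)%E.
Proof.
move=> q0 r0 C0 weak Lf; set B := (_ + ((2 * C) `^ r)%:E)%E.
have S0 : (0 <= \sum_(2 <= k <oo) (k%:R `^ q / k.-1%:R `^ r)%:E :> \bar R)%E.
  by apply: nneseries_ge0 => k _ _; rewrite lee_fin divr_ge0 ?powR_ge0.
have B0 : (0 <= B)%E by rewrite adde_ge0// lee_fin powR_ge0.
have normc_ge0 (z : R[i]) : 0 <= Normc.normc z.
  by case: z => a b; rewrite sqrtr_ge0.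
have Nfin : LpNorm p f \is a fin_num.
  by rewrite ge0_fin_numE// Lnorm_ge0.
set N := fine (LpNorm p f).
have N0 : 0 <= N by rewrite fine_ge0// Lnorm_ge0.
have NE : LpNorm p f = N%:E by rewrite fineK.
have weakN (l : R) : 0 < l ->
    (@counting X R [set x | (l < Normc.normc (T f x))%R] <=
     ((C * N / l) `^ q)%:E)%E.
  by move=> l0; have := weak f Lf l l0; rewrite NE -!EFinM poweR_EFin.
have bnd := @counting_weak_bounded R X _ _ q (mulr_ge0 (ltW C0) N0) q0 weakN.
(* If [N = 0], no normalization is possible, but the pointwise bound [C * N] makes [T f] vanish. *)
have [N00|Nn0] := eqVneq N 0.
  rewrite NE N00 mule0 /LpNorm (@eq_Lnorm _ _ _ _ _ _ (cst 0%E)) => [|x /=].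
    by rewrite Lnorm0// gt_eqF.
  by congr _%:E; apply/eqP; rewrite eq_le normc_ge0 andbT -(mulr0 C) -N00.
have Np : 0 < N by rewrite lt_neqAle eq_sym Nn0.
pose g (x : discrete X) := Normc.normc (T f x) / N.
have g0 x : 0 <= g x by rewrite divr_ge0.
have -> : LpNorm r (T f) =
    (N%:E * (\int[@counting (discrete X) R]_x (g x `^ r)%:E) `^ r^-1)%E.
  have -> : N%:E = ((N `^ r)%:E `^ r^-1)%E.
    by rewrite poweR_EFin -powRrM mulfV ?gt_eqF// powRr1.
  rewrite -poweRM ?lee_fin ?powR_ge0 ?integral_ge0//; last first.
    by move=> x _; rewrite lee_fin powR_ge0.
  rewrite /LpNorm unlock -ge0_integralZl_EFin ?powR_ge0//; last first.
    by move=> x _; rewrite lee_fin powR_ge0.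
  congr (_ `^ _)%E; apply: eq_integral => x _.
  rewrite -EFinM -powRM// mulrC divfK//.
  by rewrite abse_EFin ger0_norm// poweR_EFin.
(* Writing [C^(q/r)] as [(C^q)^(1/r)] puts the whole bound under one power [1/r], which monotonicity
   then removes. *)
rewrite NE muleC lee_wpmul2r// powRrM -poweR_EFin -poweRM ?lee_fin ?powR_ge0//.
apply: gt0_ler_poweR; rewrite ?invr_ge0 ?(ltW r0)// ?in_itv/= ?leey ?andbT.
- by apply: integral_ge0 => x _; rewrite lee_fin powR_ge0.
- by rewrite mule_ge0// lee_fin powR_ge0.
apply: le_trans (@ge0_integral_powR_weak _ _ _ _ g C C q r _ _ _ _ _ _) _ => //.
- exact: ltW.
- exact: ltW.
- by move=> x; rewrite g0 /g ler_pdivrMr//=.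
(* Level [l] for [g] is level [l * N] for [|T f|], and [N] cancels in [C * N / (l * N)]. *)
- move=> l l0; have := weakN _ (mulr_gt0 l0 Np).
  rewrite invfM mulrACA divff// mulr1.
  by under eq_set do rewrite -ltr_pdivlMr//.
(* The estimate so far has [C^r]; it is enlarged to the stated [(2C)^r]. *)
rewrite lee_wpmul2l ?lee_fin ?powR_ge0// leeD2l// lee_fin.
by rewrite ge0_ler_powR ?nnegrE ?mulr_ge0 ?(ltW r0) ?(ltW C0)//; lra.
Qed.

Theorem theorem4p3 (R : realType) (X : pointedType) (e : rel X) (kappa : nat)
    (hkappa : (2 <= kappa)%N) (htree : homogeneous_tree e kappa)
    (p q C : R) (hp : 1 <= p) (hq : 1 <= q)
    (T : (X -> R[i]) -> (X -> R[i])) (hT : weak_operator p q C T)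
    (r : R) (hr : q + 1 < r) :
  bounded_operator p r T /\
  (operator_norm p r T <=
     (C `^ (q / r))%:E *
     (\sum_(2 <= k <oo) (k%:R `^ q / k.-1%:R `^ r)%:E + ((2 * C) `^ r)%:E)
       `^ r^-1)%E.
Proof.
case: hT => lin C0 weak.
have q0 : 0 < q by lra.
have r0 : 0 < r by lra.
set M := (_ * _)%E.
have LnormT f : Lp p f -> (LpNorm r (T f) <= M * LpNorm p f)%E.
  exact: weak_operator_Lnorm_le.
have M0 : (0 <= M)%E by rewrite mule_ge0 ?poweR_ge0// lee_fin powR_ge0.
(* Convergence of the series, hence the condition [q + 1 < r], makes [M] a real constant as
   boundedness demands. *)
have Mfin : M \is a fin_num.
  rewrite ge0_fin_numE// lte_mul_pinfty ?lee_fin ?powR_ge0//.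
  by rewrite poweR_lty// lte_add_pinfty ?ltry// weak_series_lty// ltW.
split; last first.
  apply: ge_ereal_sup => _ [f [Lf f1] <-].
  by apply: le_trans (LnormT f Lf) _; rewrite -[leRHS]mule1 lee_wpmul2l.
split=> //.
- move=> f Lf; apply: le_lt_trans (LnormT f Lf) _.
  by rewrite lte_mul_pinfty.
- by exists (fine M); [rewrite fine_ge0|move=> f Lf; rewrite fineK// LnormT].
Qed.
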